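(* Let $(\mathcal{A},E)$ be a non-commutative probability space, let $X_1,X_2,\dots\in\mathcal{A}$ be free identically-distributed random variables (not necessarily self-adjoint), and let $\Pi_n=X_1X_2\cdots X_n$. Then $$\lim_{n\to\infty}n^{-1}\log\|\Pi_n\|=\log\sqrt{E(X_i^*X_i)}.$$
   Context: A non-commutative probability space $(\mathcal{A},E)$ is a unital $C^*$-algebra $\mathcal{A}$ with a positive linear functional $E$ such that $E(I)=1$ and which is tracial: $E(AB)=E(BA)$ for all $A,B\in\mathcal{A}$. It is assumed that $E$ is faithful ($E(A^*A)=0$ implies $A=0$), so that for a positive $A$ the norm $\|A\|$ is the smallest $t$ such that the spectral measure of $A$ is supported in $[0,t]$. Elements of $\mathcal{A}$ are called random variables; $\|\cdot\|$ is the operator ($C^*$-) norm. Freeness: unital subalgebras of $\mathcal{A}$ indexed by a set are free if $E(a_1\cdots a_m)=0$ whenever $a_i\in\mathcal{A}_{k(i)}$, $E(a_i)=0$ for all $i$, $k(i)\ne k(i+1)$ for every $i<m$, and $k(m)\neq k(1)$. (Since $E$ is tracial, this is equivalent to the usual definition without the condition $k(m)\ne k(1)$.) Elements (not necessarily self-adjoint) are free if the unital $*$-subalgebras they generate are free. Variables $X_i$ are identically distributed if all mixed moments of $(X_i,X_i^* )$ under $E$ do not depend on $i$. Convention: $\log 0=-\infty$. *)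

(* Defs.v *)
From HB Require Import structures.
From mathcomp Require Import all_boot all_order all_algebra.
From mathcomp Require Import complex.
From mathcomp Require Import all_classical all_reals all_analysis.

Set Implicit Arguments.
Unset Strict Implicit.
Unset Printing Implicit Defensive.

Import Order.TTheory GRing.Theory Num.Theory.
Import numFieldNormedType.Exports.

Local Open Scope classical_set_scope.
Local Open Scope ring_scope.

(** Unital C*-algebras over [R[i]], [R : realType], with a real-valued norm
    [cnorm]. The library does not provide a common substructure of algebras and
    normed modules, so the Banach-space axioms are part of the mixin. *)
HB.mixin Record isCStar (R : realType) A of GRing.Algebra R[i] A := {
  star : A -> A ;
  starK : involutive star ;
  starD : {morph star : x y / x + y} ;
  starZ : forall (c : R[i]) (x : A), star (c *: x) = Num.conj c *: star x ;
  starM : forall x y : A, star (x * y) = star y * star x ;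
  cnorm : A -> R ;
  cnorm_ge0 : forall x : A, 0 <= cnorm x ;
  cnorm_eq0 : forall x : A, cnorm x = 0 -> x = 0 ;
  cnormD_le : forall x y : A, cnorm (x + y) <= cnorm x + cnorm y ;
  cnormZ : forall (c : R[i]) (x : A),
    cnorm (c *: x) = complex.Re `|c| * cnorm x ;
  cnormM_le : forall x y : A, cnorm (x * y) <= cnorm x * cnorm y ;
  cnorm_starM : forall x : A, cnorm (star x * x) = cnorm x ^+ 2 ;
  cnorm_complete : forall u : nat -> A,
    (forall e : R, 0 < e -> exists N : nat, forall m n : nat,
       (N <= m)%N -> (N <= n)%N -> cnorm (u m - u n) < e) ->
    exists l : A, cnorm (u n - l) @[n --> \oo] --> (0 : R)
}.

#[short(type="cstarAlgType")]
HB.structure Definition CStarAlgebra (R : realType) :=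
  {A of GRing.Algebra R[i] A & isCStar R A}.

(** The order on [R[i]] is the partial order for which [0 <= z] says that [z]
    is real and nonnegative; the positive elements of a C*-algebra are the
    [star a * a]. *)
Record faithful_tracial_state (R : realType) (A : cstarAlgType R)
    (E : {scalar A}) : Prop := {
  state_positive : forall a : A, 0 <= E (star a * a) ;
  state_unit : E 1 = 1 ;
  state_tracial : forall a b : A, E (a * b) = E (b * a) ;
  state_faithful : forall a : A, E (star a * a) = 0 -> a = 0
}.

Record unital_star_subalgebra (R : realType) (A : cstarAlgType R)
    (B : set A) : Prop := {
  star_subalg1 : B 1 ;
  star_subalgD : forall x y : A, B x -> B y -> B (x + y) ;
  star_subalgZ : forall (c : R[i]) (x : A), B x -> B (c *: x) ;
  star_subalgM : forall x y : A, B x -> B y -> B (x * y) ;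
  star_subalgS : forall x : A, B x -> B (star x)
}.

Definition generated_star_subalgebra (R : realType) (A : cstarAlgType R)
    (x : A) : set A :=
  smallest (@unital_star_subalgebra R A) [set x].

(** The word [a 0, ..., a m] has [m.+1] letters; the last condition on [k] is
    the cyclic one, so that one-letter words are not constrained by it. *)
Definition free_subalgebras (R : realType) (A : cstarAlgType R)
    (E : {scalar A}) (I : Type) (B : I -> set A) : Prop :=
  forall (m : nat) (k : nat -> I) (a : nat -> A),
    (forall i, (i <= m)%N -> B (k i) (a i)) ->
    (forall i, (i <= m)%N -> E (a i) = 0) ->
    (forall i, (i < m)%N -> k i <> k i.+1) ->
    k m <> k 0%N ->
    E (\prod_(i < m.+1) a i) = 0.

Definition free_variables (R : realType) (A : cstarAlgType R)
    (E : {scalar A}) (I : Type) (X : I -> A) : Prop :=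
  free_subalgebras E (fun i => generated_star_subalgebra (X i)).

(** A boolean word [w] encodes a mixed moment of [x] and [star x]. *)
Definition mixed_moment (R : realType) (A : cstarAlgType R)
    (E : {scalar A}) (x : A) (w : seq bool) : R[i] :=
  E (\prod_(b <- w) (if b then star x else x)).

Definition identically_distributed (R : realType) (A : cstarAlgType R)
    (E : {scalar A}) (I : Type) (X : I -> A) : Prop :=
  forall (i j : I) (w : seq bool),
    mixed_moment E (X i) w = mixed_moment E (X j) w.

(* Main.v *)
(** A free product acts on its L2-space with reduced words as an orthogonal
    decomposition. If [x] is spanned by words not starting in the algebra of
    [X n], then freeness gives [|X n * x|_2 = |X n|_2 |x|_2]. For arbitrary [x],
    split [X n * x = p + q], where [p] gathers the words starting in the algebra
    of [X n]. Then [X 0 ... X (n-1)] multiplies the 2-norm of [p] by exactly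
    [s ^ n], where [s = |X j|_2], while [|q|_2 <= s |x|_2] because the map
    [x |-> q] is adjoint to left multiplication by [X n^*] on words not starting
    in the algebra of [X n]. Hence the norm [N n] of the n-fold product satisfies
    [N (n+1) <= s N n + |X j| s ^ n], so [s ^ n <= N n <= s ^ n + n |X j| s ^ (n-1)].
    That the C*-norm is controlled by the L2-action follows from faithfulness:
    if [E (b ^ 2k) <= c ^ 2k] for all [k] and [b] is self-adjoint, then the
    positive part of [b ^ 2 - l] vanishes for all [l > c ^ 2]. *)
Require Import Defs.
From HB Require Import structures.
From mathcomp Require Import all_boot all_order all_algebra.
From mathcomp Require Import complex.
From mathcomp Require Import all_classical all_reals all_analysis.
From mathcomp Require Import ring lra.
Import Order.TTheory GRing.Theory Num.Theory.
Import numFieldNormedType.Exports.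
Local Open Scope classical_set_scope.
Local Open Scope ring_scope.

Local Notation "r %:C" := (real_complex _ r) : ring_scope.

(** * Norm and involution; square roots by iteration *)

Section CStarBasics.
Set Implicit Arguments.
Unset Strict Implicit.
Variables (R : realType) (A : cstarAlgType R).
Implicit Types (x y z : A) (r : R).

Lemma star0 : star (0 : A) = 0.
Proof. by apply: (addrI (star (0 : A))); rewrite -starD !addr0. Qed.

Lemma starN x : star (- x) = - star x.
Proof. by apply: (addrI (star x)); rewrite -starD !addrN star0. Qed.

Lemma starB x y : star (x - y) = star x - star y.
Proof. by rewrite starD starN. Qed.

Lemma star1 : star (1 : A) = 1.
Proof. by rewrite -[LHS]mulr1 -{2}(starK 1) -starM mulr1 starK. Qed.

Lemma starX x k : star (x ^+ k) = star x ^+ k.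
Proof. by elim: k => [|k IH]; rewrite ?star1 // exprS starM IH -exprSr. Qed.

Lemma star_realZ r x : star (r%:C *: x) = r%:C *: star x.
Proof. by rewrite starZ; congr (_ *: _); rewrite /Num.conj /= oppr0. Qed.

Lemma cnorm_realZ r x : cnorm (r%:C *: x) = `|r| * cnorm x.
Proof. by rewrite cnormZ normc_def /= expr0n addr0 sqrtr_sqr. Qed.

Lemma cnormN x : cnorm (- x) = cnorm x.
Proof. by rewrite -scaleN1r cnormZ normrN1 mul1r. Qed.

Lemma cnormB_le x y : cnorm (x - y) <= cnorm x + cnorm y.
Proof. by rewrite -(cnormN y) cnormD_le. Qed.

Lemma cnormBC x y : cnorm (x - y) = cnorm (y - x).
Proof. by rewrite -cnormN opprB. Qed.

Lemma cnorm0 : cnorm (0 : A) = 0.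
Proof. by rewrite -(scale0r 0) cnormZ normr0 mul0r. Qed.

Lemma cnorm_gt0 x : x != 0 -> 0 < cnorm x.
Proof.
move=> x0; rewrite lt_neqAle cnorm_ge0 andbT eq_sym; apply/eqP => /cnorm_eq0 e.
by rewrite e eqxx in x0.
Qed.

Lemma cnorm_star x : cnorm (star x) = cnorm x.
Proof.
have le y : cnorm y <= cnorm (star y).
  have [->|/cnorm_gt0 y0] := eqVneq y 0; first by rewrite star0.
  by rewrite -(ler_pM2r y0) -expr2 -cnorm_starM cnormM_le.
by apply/le_anti; rewrite le -{2}(starK x) le.
Qed.

Lemma cnorm1 : cnorm (1 : A) = 1.
Proof.
have n0 : cnorm (1 : A) != 0 by rewrite gt_eqF// cnorm_gt0// oner_neq0.
by apply: (mulfI n0); rewrite mulr1 -expr2 -cnorm_starM star1 mul1r.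
Qed.

Lemma cnormX_le x k : cnorm (x ^+ k) <= cnorm x ^+ k.
Proof.
elim: k => [|k IH]; first by rewrite !expr0 cnorm1.
by rewrite !exprS (le_trans (cnormM_le _ _))// ler_wpM2l// cnorm_ge0.
Qed.

Lemma cnorm_sqr_sa x : star x = x -> cnorm (x ^+ 2) = cnorm x ^+ 2.
Proof. by move=> xs; rewrite -cnorm_starM xs. Qed.

(** [b + i g] is [sqrt l] times a unitary, and [2 b] is the sum of it and its
    adjoint. *)
Lemma cnorm_le_of_sum_sqr (b g : A) (l : R) : 0 <= l ->
  star b = b -> star g = g -> g * b = b * g -> b ^+ 2 + g ^+ 2 = l%:C *: 1 ->
  cnorm b ^+ 2 <= l.
Proof.
move=> l0 bs gs bg e; pose u := b + 'i%C *: g.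
have us : star u = b - 'i%C *: g.
  have ci : Num.conj 'i%C = - 'i%C :> R[i] by apply/eqP; rewrite eq_complex /= oppr0 !eqxx.
  by rewrite starD starZ bs gs -scaleNr ci.
have uu : star u * u = l%:C *: 1.
  rewrite us -e !expr2 mulrDr !mulrBl -!scalerAl -!scalerAr scalerA bg.
  have -> : 'i%C * 'i%C = -1 :> R[i] by rewrite -expr2 sqr_i.
  by rewrite scaleN1r opprK addrA subrK.
have un : cnorm u ^+ 2 = l by rewrite -cnorm_starM uu cnorm_realZ cnorm1 mulr1 ger0_norm.
have : cnorm (b + b) <= cnorm u + cnorm u.
  have -> : b + b = u + star u by rewrite us addrACA subrr addr0.
  by rewrite (le_trans (cnormD_le _ _))// cnorm_star.
have -> : b + b = 2%:R%:C *: b by rewrite rmorph_nat scaler_nat mulr2n.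
rewrite cnorm_realZ -un ger0_norm// => h.
by rewrite ler_sqr ?nnegrE ?cnorm_ge0//; lra.
Qed.

(** Iterates of [y = (x + y ^ 2) / 2], whose fixed points satisfy [(1 - y) ^ 2 = 1 - x]. Their limit
    takes the place of functional calculus. *)
Fixpoint sqrt_seq x k : A :=
  if k is k'.+1 then (2^-1)%:C *: (x + sqrt_seq x k' ^+ 2) else 0.

(** The scalar iteration at [x = 1], a majorant when [cnorm x <= 1]. *)
Fixpoint sqrt_bound k : R := if k is k'.+1 then (1 + sqrt_bound k' ^+ 2) / 2 else 0.

Lemma sqrt_seqS x k : sqrt_seq x k.+1 = (2^-1)%:C *: (x + sqrt_seq x k ^+ 2).
Proof. by []. Qed.

Lemma sqrt_boundS k : sqrt_bound k.+1 = (1 + sqrt_bound k ^+ 2) / 2.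
Proof. by []. Qed.

Lemma sqrt_bound_itv k : 0 <= sqrt_bound k <= 1.
Proof. elim: k => [|k /andP[h0 h1]] /=; [by rewrite lexx ler01|apply/andP; split; nra]. Qed.

Lemma sqrt_bound_nd : {homo sqrt_bound : m n / (m <= n)%N >-> m <= n}.
Proof.
apply: homo_leq => [//|y x z|]; first exact: le_trans.
by move=> k; rewrite /=; have := sqr_ge0 (sqrt_bound k - 1); nra.
Qed.

Lemma sqrt_seq_le x k : cnorm x <= 1 -> cnorm (sqrt_seq x k) <= sqrt_bound k.
Proof.
move=> x1; elim: k => [|k IH] /=; first by rewrite cnorm0.
rewrite cnorm_realZ ger0_norm ?invr_ge0// mulrC ler_pM2r ?invr_gt0//.
rewrite (le_trans (cnormD_le _ _))// lerD// (le_trans (cnormX_le _ _))//.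
by rewrite lerXn2r ?nnegrE ?cnorm_ge0// (andP (sqrt_bound_itv k)).1.
Qed.

Lemma subr_sqr_nc (x y : A) : x ^+ 2 - y ^+ 2 = (x - y) * x + y * (x - y).
Proof. by rewrite mulrBl mulrBr -!expr2 addrA subrK. Qed.

(** The iteration has nonnegative coefficients, so its increments are dominated by the scalar ones;
    [subr_sqr_nc] factors differences of squares without commutativity. *)
Lemma sqrt_seq_step x k : cnorm x <= 1 ->
  cnorm (sqrt_seq x k.+1 - sqrt_seq x k) <= sqrt_bound k.+1 - sqrt_bound k.
Proof.
move=> x1; elim: k => [|k IH].
  by rewrite !subr0 sqrt_seq_le.
rewrite (sqrt_seqS x k.+1) [in X in _ - X](sqrt_seqS x k).
rewrite (sqrt_boundS k.+1) [in X in _ <= _ - X](sqrt_boundS k).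
rewrite -scalerBr opprD addrACA subrr add0r subr_sqr_nc cnorm_realZ ger0_norm ?invr_ge0//.
have -> : (1 + sqrt_bound k.+1 ^+ 2) / 2 - (1 + sqrt_bound k ^+ 2) / 2 =
  2^-1 * ((sqrt_bound k.+1 - sqrt_bound k) * sqrt_bound k.+1 +
          sqrt_bound k * (sqrt_bound k.+1 - sqrt_bound k)) by field.
rewrite ler_wpM2l ?invr_ge0// (le_trans (cnormD_le _ _))// lerD//;
  rewrite (le_trans (cnormM_le _ _))// ler_pM ?cnorm_ge0//; exact: sqrt_seq_le.
Qed.

Lemma sqrt_seq_dist x m n : cnorm x <= 1 -> (m <= n)%N ->
  cnorm (sqrt_seq x n - sqrt_seq x m) <= sqrt_bound n - sqrt_bound m.
Proof.
move=> x1; elim: n => [|n IH]; first by rewrite leqn0 => /eqP->; rewrite !subrr cnorm0.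
rewrite leq_eqVlt => /predU1P[->|]; first by rewrite !subrr cnorm0.
rewrite ltnS => /IH mn; rewrite -(subrKA (sqrt_seq x n)) (le_trans (cnormD_le _ _))//.
by have := sqrt_seq_step n x1; lra.
Qed.

Lemma sqrt_seq_sa x k : star x = x -> star (sqrt_seq x k) = sqrt_seq x k.
Proof.
by move=> xs; elim: k => [|k IH] /=; rewrite ?star0// star_realZ starD starX IH xs.
Qed.

Lemma sqrt_seq_comm x z k : GRing.comm z x -> GRing.comm z (sqrt_seq x k).
Proof.
move=> zx; elim: k => [|k IH] /=; first exact: commr0.
by rewrite /GRing.comm -scalerAl -scalerAr; congr (_ *: _); apply: commrD => //; apply: commrX.
Qed.

Lemma sqrt_seq_cvg x : cnorm x <= 1 ->
  exists l : A, cnorm (sqrt_seq x k - l) @[k --> \oo] --> (0 : R).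
Proof.
move=> x1; apply: cnorm_complete => e e0.
have cs : cvgn sqrt_bound.
  apply: nondecreasing_is_cvgn; first exact: sqrt_bound_nd.
  by exists 1 => _ [k _ <-]; rewrite (andP (sqrt_bound_itv k)).2.
have /cvgrPdist_lt/(_ (e / 2)) := cs; rewrite divr_gt0// => /(_ isT)[N _ hN].
exists N => m n Nm Nn; wlog mn : m n Nm Nn / (m <= n)%N.
  by move=> h; case/orP: (leq_total m n) => ?; [|rewrite cnormBC]; apply: h.
rewrite cnormBC (le_lt_trans (sqrt_seq_dist x1 mn))//.
have := hN m Nm; have := hN n Nn; rewrite !ltr_norml => /andP[? ?] /andP[? ?]; lra.
Qed.

Lemma ler_mul_eps (c K : R) : (forall e, 0 < e -> c <= K * e) -> c <= 0.
Proof.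
move=> h; rewrite leNgt; apply/negP => c0; have K0 : 0 < `|K| + 1 by rewrite ltr_pwDr.
have := h (c / (2 * (`|K| + 1))); rewrite divr_gt0 ?mulr_gt0// => /(_ isT).
rewrite leNgt => /negP; apply; rewrite mulrCA gtr_pMr// ltr_pdivrMr ?mulr_gt0// mul1r.
by have := ler_norm K; have := normr_ge0 K; lra.
Qed.

Lemma cnorm_small_eq x y K : (forall e, 0 < e -> cnorm (x - y) <= K * e) -> x = y.
Proof.
move=> /ler_mul_eps h; apply/eqP; rewrite -subr_eq0; apply/eqP/cnorm_eq0/le_anti.
by rewrite h cnorm_ge0.
Qed.

(** The limit [y] is returned instead of the root [1 - y], because [cnorm y <= 1] allows the lemma
    to be applied to [y] again. *)
Lemma sqrt1B_exists x : star x = x -> cnorm x <= 1 -> exists y,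
  [/\ star y = y, (1 - y) ^+ 2 = 1 - x, cnorm y <= 1 &
      forall z, GRing.comm z x -> GRing.comm z y].
Proof.
move=> xs x1; have [l /cvgr0Pnorm_lt ll] := sqrt_seq_cvg x1.
(* One iterate near [l] carries every property to be passed to the limit; the last clause is the
   next iterate, whence the fixed-point equation for [l]. *)
have near e : 0 < e -> exists y, [/\ star y = y, cnorm y <= 1,
    forall z, GRing.comm z x -> GRing.comm z y,
    cnorm (y - l) <= e & cnorm ((2^-1)%:C *: (x + y ^+ 2) - l) <= e].
  move=> e0; have [N _ hN] := ll _ e0; exists (sqrt_seq x N); split.
  - exact: sqrt_seq_sa.
  - by rewrite (le_trans (sqrt_seq_le _ _))// (andP (sqrt_bound_itv N)).2.
  - by move=> z; apply: sqrt_seq_comm.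
  - by have := hN N (leqnn N); rewrite /= ger0_norm ?cnorm_ge0// => /ltW.
  - by have := hN N.+1 (leqnSn N); rewrite /= ger0_norm ?cnorm_ge0// => /ltW.
have l1 : cnorm l <= 1.
  rewrite -subr_le0; apply: (@ler_mul_eps _ 1) => e /near[y [_ y1 _ yl _]].
  have := cnormB_le y (y - l); rewrite opprB addrC subrK; lra.
exists l; split => //.
- apply: (@cnorm_small_eq _ _ 2) => e /near[y [ys _ _ yl _]].
  rewrite -(subrKA y) (le_trans (cnormD_le _ _))// -{1}ys -starB cnorm_star cnormBC; lra.
- suff e : l = (2^-1)%:C *: (x + l ^+ 2).
    have {}e : l + l = x + l ^+ 2.
      rewrite -mulr2n {1}e -scaler_nat scalerA -(rmorph_nat (real_complex R)) -rmorphM/=.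
      by rewrite divff// scale1r.
    have -> : x = l + l - l ^+ 2 by rewrite e addrK.
    rewrite expr2 mulrBl !mulrBr !mul1r mulr1 -expr2 !opprB opprD -!addrA.
    by rewrite [in LHS](addrCA (- l)).
  apply: (@cnorm_small_eq _ _ 2) => e /near[y [_ y1 _ yl yl']].
  rewrite -(subrKA ((2^-1)%:C *: (x + y ^+ 2))) (le_trans (cnormD_le _ _))//.
  rewrite cnormBC -scalerBr opprD (addrACA x) subrr add0r subr_sqr_nc.
  rewrite cnorm_realZ ger0_norm ?invr_ge0//.
  have : cnorm ((y - l) * y + l * (y - l)) <= e * 1 + 1 * e.
    rewrite (le_trans (cnormD_le _ _))// lerD//;
      by rewrite (le_trans (cnormM_le _ _))// ler_pM ?cnorm_ge0.
  lra.
- move=> z zx; apply: (@cnorm_small_eq _ _ (2 * cnorm z)) => e /near[y [_ _ yc yl _]].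
  rewrite -(subrKA (z * y)) (le_trans (cnormD_le _ _))// {2}(yc z zx) -mulrBl -mulrBr.
  have h1 := cnormM_le z (l - y); have h2 := cnormM_le (y - l) z.
  have := cnorm_ge0 z; rewrite cnormBC in h1; nra.
Qed.

End CStarBasics.

Section TracialState.
Set Implicit Arguments.
Unset Strict Implicit.
Variables (R : realType) (A : cstarAlgType R) (E : {scalar A}).
Hypothesis hE : faithful_tracial_state E.
Implicit Types (x y z : A) (r : R).

Definition dot x y : R := complex.Re (E (star x * y)).

Definition norm2 x : R := Num.sqrt (dot x x).

Lemma ReD (u v : R[i]) : complex.Re (u + v) = complex.Re u + complex.Re v.
Proof. by case: u v => ? ? [? ?]. Qed.

Lemma ReN (u : R[i]) : complex.Re (- u) = - complex.Re u.
Proof. by case: u. Qed.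

Lemma Re_realM r (u : R[i]) : complex.Re (r%:C * u) = r * complex.Re u.
Proof. by case: u => a b /=; rewrite mul0r subr0. Qed.

Lemma dotDl x y z : dot (x + y) z = dot x z + dot y z.
Proof. by rewrite /dot starD mulrDl linearD ReD. Qed.

Lemma dotDr x y z : dot x (y + z) = dot x y + dot x z.
Proof. by rewrite /dot mulrDr linearD ReD. Qed.

Lemma dotNr x y : dot x (- y) = - dot x y.
Proof. by rewrite /dot mulrN linearN ReN. Qed.

Lemma dotZr r x y : dot x (r%:C *: y) = r * dot x y.
Proof. by rewrite /dot -scalerAr linearZ Re_realM. Qed.

Lemma dotZl r x y : dot (r%:C *: x) y = r * dot x y.
Proof. by rewrite /dot star_realZ -scalerAl linearZ Re_realM. Qed.

Lemma dot_mull a x y : dot (a * x) y = dot x (star a * y).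
Proof. by rewrite /dot starM mulrA. Qed.

(** Positivity at [1 + z] makes [E z + E (star z)] real; taking [z = x] and then [z = 'i%C *: x]
    settles the imaginary and the real part. *)
Lemma state_star x : E (star x) = Num.conj (E x).
Proof.
have im z : complex.Im (E z) + complex.Im (E (star z)) = 0.
  have i0 w : complex.Im (E (star w * w)) = 0 by apply: ger0_Im; apply: state_positive.
  have ImD (u v : R[i]) : complex.Im (u + v) = complex.Im u + complex.Im v.
    by case: u v => ? ? [? ?].
  have := i0 (1 + z); rewrite starD star1 mulrDl !mulrDr !mul1r mulr1.
  by rewrite !(linearD E) !ImD i0 (state_unit hE) /= add0r addr0.
have := im x; have := im ('i%C *: x); rewrite starZ !linearZ /=.
case: (E x) (E (star x)) => a b [c d] /= h1 h2.
by apply/eqP; rewrite eq_complex /=; apply/andP; split; apply/eqP; lra.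
Qed.

Lemma dotC x y : dot x y = dot y x.
Proof. by rewrite /dot -{1}(starK y) -starM state_star; case: (E _). Qed.

Lemma dot_ge0 x : 0 <= dot x x.
Proof. by have := state_positive hE x; rewrite lecE => /andP[_]. Qed.

Lemma dot_eq0 x : dot x x = 0 -> x = 0.
Proof.
move=> h; apply: (state_faithful hE); have := ger0_Im (state_positive hE x).
by move: h; rewrite /dot; case: (E _) => a b /= -> ->.
Qed.

Lemma norm2_ge0 x : 0 <= norm2 x. Proof. exact: sqrtr_ge0. Qed.

Lemma sqr_norm2 x : norm2 x ^+ 2 = dot x x.
Proof. by rewrite sqr_sqrtr ?dot_ge0. Qed.

Lemma norm2_eq0 x : norm2 x = 0 -> x = 0.
Proof. by move=> h; apply: dot_eq0; rewrite -sqr_norm2 h expr0n. Qed.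

Lemma norm2_1 : norm2 1 = 1.
Proof. by rewrite /norm2 /dot star1 mul1r state_unit//= sqrtr1. Qed.

Lemma norm2_0 : norm2 0 = 0.
Proof. by rewrite /norm2 /dot mulr0 linear0 /= sqrtr0. Qed.

Lemma dot_le_norm2 x y : dot x y <= norm2 x * norm2 y.
Proof.
have [->|y0] := eqVneq y 0.
  by rewrite norm2_0 mulr0 /dot mulr0 linear0.
have n0 : 0 < norm2 y.
  rewrite lt_neqAle norm2_ge0 andbT eq_sym; apply/eqP => /norm2_eq0 e.
  by rewrite e eqxx in y0.
have := dot_ge0 ((norm2 y ^+ 2)%:C *: x - (dot x y)%:C *: y).
rewrite !(dotDl, dotDr) -!scaleNr -!rmorphN !(dotZl, dotZr) (dotC y x) -!sqr_norm2.
set u := norm2 x; set v := norm2 y; set d := dot x y => h.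
have v2 : 0 < v ^+ 2 by rewrite exprn_gt0.
have {}h : d ^+ 2 <= (u * v) ^+ 2.
  rewrite -subr_ge0 -(pmulr_rge0 _ v2) (le_trans h)// le_eqVlt; apply/orP; left.
  by apply/eqP; ring.
have uv : 0 <= u * v by rewrite mulr_ge0// norm2_ge0.
by rewrite (le_trans (ler_norm d))// -(ger0_norm uv) -!sqrtr_sqr ler_wsqrtr.
Qed.

Lemma norm2D_le x y : norm2 (x + y) <= norm2 x + norm2 y.
Proof.
have xy : 0 <= norm2 x + norm2 y by rewrite addr_ge0 ?norm2_ge0.
rewrite -ler_sqr ?nnegrE ?norm2_ge0// sqr_norm2 dotDl !dotDr (dotC y x) -!sqr_norm2.
by have := dot_le_norm2 x y; nra.
Qed.

Lemma norm2D_orth x y : dot x y = 0 -> norm2 (x + y) ^+ 2 = norm2 x ^+ 2 + norm2 y ^+ 2.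
Proof. by move=> xy; rewrite !sqr_norm2 dotDl !dotDr (dotC y x) xy addr0 add0r. Qed.

(** [|a|^2 - a^* a] is a square by [sqrt1B_exists]. *)
Lemma norm2M_le a x : norm2 (a * x) <= cnorm a * norm2 x.
Proof.
have [->|/cnorm_gt0 a0] := eqVneq a 0.
  by rewrite mul0r norm2_0 cnorm0 mul0r.
pose q := (cnorm a ^- 2)%:C *: (star a * a).
have qs : star q = q by rewrite star_realZ starM starK.
have q1 : cnorm q <= 1.
  rewrite cnorm_realZ cnorm_starM ger0_norm ?invr_ge0 ?exprn_ge0 ?cnorm_ge0//.
  by rewrite mulVf// expf_neq0// gt_eqF.
have [y [ys ye _ _]] := sqrt1B_exists qs q1.
have := dot_ge0 ((1 - y) * x).
rewrite dot_mull starB star1 ys mulrA -expr2 ye mulrBl mul1r dotDr dotNr.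
rewrite -scalerAl dotZr -mulrA -dot_mull -!sqr_norm2 subr_ge0 => h.
rewrite -ler_sqr ?nnegrE ?mulr_ge0 ?cnorm_ge0 ?norm2_ge0// exprMn.
by move: h; rewrite mulrC ler_pdivrMr ?exprn_gt0// mulrC.
Qed.

(** By traciality, right multiplication by a self-adjoint [w] is symmetric, so right multiplication
    by [w ^+ 2] is positive. *)
Lemma dot_mulr_sqr x w : star w = w -> dot x (x * w ^+ 2) = dot (x * w) (x * w).
Proof.
move=> ws; rewrite /dot starM ws expr2 -mulrA !(mulrA x) (mulrA (star x)).
by rewrite (state_tracial hE).
Qed.

Lemma geometric_le0 (a K l m : R) : 0 <= m -> m < l ->
  (forall k, l ^+ k * a <= K * m ^+ k) -> a <= 0.
Proof.
move=> m0 ml h; have l0 := le_lt_trans m0 ml.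
apply: (@ler_mul_eps _ _ `|K|) => e e0.
have q1 : `|m / l| < 1 by rewrite ger0_norm ?ltr_pdivrMr ?mul1r ?divr_ge0 ?(ltW l0).
have /cvgr0Pnorm_lt/(_ e e0)[N _ /(_ N (leqnn N))] := cvg_expr q1.
rewrite /= => /ltW hN; apply: (@le_trans _ _ (K * (m / l) ^+ N)).
  by rewrite expr_div_n mulrA ler_pdivlMr ?exprn_gt0// mulrC h.
by rewrite (le_trans (ler_norm _))// normrM ler_wpM2l.
Qed.

(** [p] is twice the positive part of [t = (s - l) / M] with [s = b ^ 2], so
    that [s] acts as an operator [>= l] on the range of [p]; the moment bound
    then forces [p = 0], i.e. [s <= l]. *)
Lemma cnorm_le_moments (b : A) (c : R) : star b = b -> 0 <= c ->
  (forall k, norm2 (b ^+ k) <= c ^+ k) -> cnorm b <= c.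
Proof.
move=> bs c0 mom; rewrite -ler_sqr ?nnegrE ?cnorm_ge0//.
apply/ler_addgt0Pl => e e0; set l := e + c ^+ 2.
have cl : c ^+ 2 < l by rewrite ltr_pwDl.
have l0 : 0 < l by rewrite (le_lt_trans _ cl) ?sqr_ge0.
pose s := b ^+ 2; pose M := cnorm s + l.
have M0 : 0 < M by rewrite ltr_wpDl ?cnorm_ge0.
(* Dividing by [M] gives [cnorm t <= 1], as [sqrt1B_exists] requires. *)
pose t := (M^-1)%:C *: (s - l%:C *: 1).
have ss : star s = s by rewrite starX bs.
have ts : star t = t by rewrite star_realZ starB star_realZ ss star1.
have t1 : cnorm t <= 1.
  rewrite cnorm_realZ ger0_norm ?invr_ge0 ?(ltW M0)// mulrC ler_pdivrMr// mul1r.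
  by rewrite (le_trans (cnormB_le _ _))// cnorm_realZ cnorm1 mulr1 gtr0_norm.
have st : s = l%:C *: 1 + M%:C *: t.
  by rewrite scalerA -rmorphM/= divff ?gt_eqF// scale1r addrC subrK.
have bt : GRing.comm b t.
  rewrite /GRing.comm /t -scalerAr -scalerAl mulrBl mulrBr -scalerAr -scalerAl.
  by rewrite mulr1 mul1r -exprS -exprSr.
clearbody t.
have [w1 [w1s w1e w1c]] : exists w, [/\ star w = w, w ^+ 2 = 1 - t ^+ 2 &
    forall z, GRing.comm z t -> GRing.comm z w].
  have t2s : star (t ^+ 2) = t ^+ 2 by rewrite starX ts.
  have t21 : cnorm (t ^+ 2) <= 1 by rewrite cnorm_sqr_sa// expr_le1 ?cnorm_ge0.
  have [y [ys ye _ yc]] := sqrt1B_exists t2s t21.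
  exists (1 - y); split=> //; first by rewrite starB star1 ys.
  by move=> z zt; apply: commrB; [exact: commr1|apply: yc; exact: commrX].
(* From [w1 ^ 2 + t ^ 2 = 1]. This permits a root of [t ^ 2 = 1 - (1 - t ^ 2)]. *)
have w11 : cnorm (1 - t ^+ 2) <= 1.
  rewrite -w1e cnorm_sqr_sa//; apply: (@cnorm_le_of_sum_sqr _ _ w1 t) => //.
    exact: w1c.
  by rewrite w1e subrK scale1r.
have [y [ys ye y1 yc]] : exists y, [/\ star y = y, (1 - y) ^+ 2 = t ^+ 2, cnorm y <= 1 &
    forall z, GRing.comm z t -> GRing.comm z y].
  have xs : star (1 - t ^+ 2) = 1 - t ^+ 2 by rewrite starB star1 starX ts.
  have [y [ys ye y1 yc]] := sqrt1B_exists xs w11; exists y; split=> //.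
    by rewrite ye opprB addrC subrK.
  by move=> z zt; apply: yc; apply: commrB; [exact: commr1|exact: commrX].
have [y' [y's y'e _ y'c]] := sqrt1B_exists ys y1.
(* [v] plays the role of the absolute value of [t], and [w] that of the square root of [v]. *)
pose v := 1 - y; pose w := 1 - y'; pose p := v + t.
have vs : star v = v by rewrite starB star1 ys.
have ws : star w = w by rewrite starB star1 y's.
have v2 : v ^+ 2 = t ^+ 2 by [].
have w2 : w ^+ 2 = v by [].
have wc z : GRing.comm z t -> GRing.comm z w.
  by move=> zt; apply: commrB; [exact: commr1|apply: y'c; exact: yc].
have vt : v * t = t * v.
  by apply/esym/commrB; [exact: commr1|apply: yc].
clearbody v w.
have pt : p * t = p * v by rewrite (mulrDl v t t) (mulrDl v t v) vt -!expr2 v2 addrC.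
have ps : p * s = l%:C *: p + M%:C *: (p * v).
  by rewrite st mulrDr -!scalerAr mulr1 pt.
have sp : s * p = p * s.
  rewrite st mulrDl (mulrDr p) -!scalerAl -!scalerAr mulr1 mul1r; congr (_ + _ *: _).
  by rewrite (mulrDr t v t) (mulrDl v t t) vt.
have fe k : s ^+ k.+1 * p = l%:C *: (s ^+ k * p) + M%:C *: (s ^+ k * p * w ^+ 2).
  by rewrite w2 exprSr -mulrA sp ps mulrDr -!scalerAr mulrA.
(* With [f = s ^ k p], the square of the 2-norm of [l f + M f w ^ 2] is at least that of [l f]: the
   cross term is nonnegative by [dot_mulr_sqr]. *)
have lower k : l ^+ k * norm2 p <= norm2 (s ^+ k * p).
  elim: k => [|k IH]; first by rewrite expr0 !mul1r.
  rewrite exprS -mulrA (le_trans (ler_wpM2l (ltW l0) IH))//.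
  rewrite -ler_sqr ?nnegrE ?mulr_ge0 ?norm2_ge0 ?(ltW l0)// exprMn !sqr_norm2.
  rewrite fe; set f := s ^+ k * p; rewrite !(dotDl, dotDr, dotZl, dotZr).
  rewrite (dotC (f * w ^+ 2) f) dot_mulr_sqr//.
  have h1 := dot_ge0 (f * w); have h2 := dot_ge0 (f * w ^+ 2).
  have Ml : 0 <= l * (M * dot (f * w) (f * w)) by rewrite !mulr_ge0 ?(ltW l0) ?(ltW M0).
  have MM : 0 <= M * (M * dot (f * w ^+ 2) (f * w ^+ 2)) by rewrite !mulr_ge0 ?(ltW M0).
  rewrite expr2; nra.
have upper k : norm2 (s ^+ k * p) <= cnorm p * (c ^+ 2) ^+ k.
  have -> : s ^+ k * p = p * s ^+ k by apply/esym/commrX/esym.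
  by rewrite (le_trans (norm2M_le _ _))// ler_wpM2l ?cnorm_ge0// -!exprM.
have p0 : p = 0.
  apply: norm2_eq0; apply/le_anti; rewrite norm2_ge0 andbT.
  apply: (@geometric_le0 _ (cnorm p) l (c ^+ 2)); rewrite ?sqr_ge0// => k.
  exact: le_trans (lower k) (upper k).
(* Now [b ^ 2 + M w ^ 2 = l], a sum of two commuting self-adjoint squares. *)
have tw : t = - w ^+ 2 by apply/eqP; rewrite w2 -addr_eq0 addrC; apply/eqP.
apply: (@cnorm_le_of_sum_sqr _ _ b ((Num.sqrt M)%:C *: w)) => //; first exact: ltW.
- by rewrite star_realZ ws.
- rewrite -scalerAl -scalerAr; congr (_ *: _); exact/esym/wc.
- rewrite exprZn -rmorphXn/= sqr_sqrtr ?ltW// -/s st tw scalerN subrK //.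
Qed.

End TracialState.

(** * Reduced words in free subalgebras *)

Section ReducedWords.
Set Implicit Arguments.
Unset Strict Implicit.
Variables (R : realType) (A : cstarAlgType R) (E : {scalar A}).
Hypothesis hE : faithful_tracial_state E.
Variables (I : eqType) (B : I -> set A).
Hypothesis hB : forall i, unital_star_subalgebra (B i).
Hypothesis hfree : free_subalgebras E B.
Implicit Types (P Q : pred (seq (I * A))) (i : I) (a x y : A) (s t : seq (I * A)) (c : R[i]).
Local Notation dot := (dot E).
Local Notation norm2 := (norm2 E).

Definition wprod s : A := \prod_(u <- s) u.2.

(** The empty word starts in no algebra, so scalars count as words not starting in [B i]. *)
Definition starts i s : bool := if s is u :: _ then u.1 == i else false.

Fixpoint reduced s : Prop :=
  if s is u :: s' then
    [/\ B u.1 u.2, E u.2 = 0, ~~ starts u.1 s' & reduced s']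
  else True.

Definition center a : A := a - E a *: 1.

Lemma wprod_cons u s : wprod (u :: s) = u.2 * wprod s.
Proof. exact: big_cons. Qed.

Lemma state_center a : E (center a) = 0.
Proof. by rewrite linearB linearZ /= (state_unit hE) mulr1 subrr. Qed.

Lemma subalg_center i a : B i a -> B i (center a).
Proof.
move=> ba; apply: (star_subalgD (hB i)) => //; rewrite -scaleNr.
by apply: (star_subalgZ (hB i)); exact: star_subalg1.
Qed.

Lemma reduced_nth u0 s : reduced s -> forall k, (k < size s)%N ->
  [/\ B (nth u0 s k).1 (nth u0 s k).2, E (nth u0 s k).2 = 0 &
      (k.+1 < size s)%N -> (nth u0 s k).1 <> (nth u0 s k.+1).1].
Proof.
elim: s => [//|u s IH] /= [bu eu su /IH{}IH] [_|k]; last by rewrite ltnS; apply: IH.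
by split=> //; case: s su {IH} => [//|v s] /= vu _ e; rewrite e eqxx in vu.
Qed.

Lemma reduced_rcons s v : reduced (rcons s v) -> [/\ reduced s, B v.1 v.2 & E v.2 = 0].
Proof.
elim: s => [|u s IH] /=; first by case.
move=> [bu eu su /IH[rs bv ev]]; split=> //; split=> //.
by case: s su {IH rs}.
Qed.

(** Freeness in the cyclic form gives the usual one: if the first and the last
    letters lie in the same algebra, traciality merges them. *)
Lemma state_reduced s : s != [::] -> reduced s -> E (wprod s) = 0.
Proof.
have [n] := ubnP (size s); elim: n s => // n IH [//|u s] /= sn _ us.
have [bu eu nu rs] := us.
case: (lastP s) us nu rs sn => [|{}s v] us nu rs sn.
  by rewrite wprod_cons /wprod big_nil mulr1.
have [vu|/eqP vu] := eqVneq v.1 u.1; last first.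
  rewrite /wprod (big_nth u) big_mkord.
  have rn := @reduced_nth u (u :: rcons s v) us.
  apply: (hfree (m := size (rcons s v)) (k := fun k => (nth u (u :: rcons s v) k).1)
                (a := fun k => (nth u (u :: rcons s v) k).2)).
  - by move=> k /rn[].
  - by move=> k /rn[].
  - by move=> k ks; have [//|_ _] := rn k; [exact: ltnW|exact].
  - by rewrite size_rcons -cats1 /= nth_cat ltnn subnn.
have [rs' bv _] := reduced_rcons rs.
have -> : E (wprod (u :: rcons s v)) = E ((v.2 * u.2) * wprod s).
  by rewrite wprod_cons /wprod big_rcons /= mulrA (state_tracial hE) mulrA.
have s0 : s != [::] by apply/eqP => e; move: nu; rewrite e /= vu eqxx.
have ns : ~~ starts u.1 s by case: (s) nu.
have ss : ((size s).+1 < n)%N by move: sn; rewrite ltnS size_rcons.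
set w := v.2 * u.2; have bw : B u.1 w by apply: (star_subalgM (hB _)) => //; rewrite -vu.
(* The scalar and the centred part of the merged letter each leave a shorter reduced word. *)
have -> : w = E w *: 1 + center w by rewrite addrC subrK.
rewrite mulrDl -scalerAl mul1r linearD linearZ /= IH// ?(ltnW ss)// mulr0 add0r.
rewrite -(wprod_cons (u.1, center w)); apply: IH => //=; split=> //.
  exact: subalg_center.
exact: state_center.
Qed.

(** The letters of [s] are moved, adjointed, one by one to the front of [t]; nothing merges, since
    the first letters of [s] and [t] lie in different algebras. The length serves to see that the
    word is nonempty. *)
Lemma star_mul_reduced s t : reduced s -> reduced t ->
  (if s is u :: _ then ~~ starts u.1 t else true) ->
  exists2 r, reduced r & wprod r = star (wprod s) * wprod t /\ size r = (size s + size t)%N.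
Proof.
elim: s t => [|u s IH] t /=; first by exists t => //; rewrite /wprod big_nil star1 mul1r.
move=> [bu eu us rs] rt ut.
have [|||r rr [re rz]] := IH ((u.1, star u.2) :: t) => //=.
- split=> //; first exact: (star_subalgS (hB _)).
  by rewrite (state_star hE) eu conjC0.
- by case: s us {IH rs} => //= v s; rewrite eq_sym.
by exists r => //; rewrite re rz !wprod_cons starM mulrA addnS.
Qed.

Lemma star_mul_reduced0 i s t : reduced s -> reduced t -> starts i s -> ~~ starts i t ->
  E (star (wprod s) * wprod t) = 0.
Proof.
case: s => [//|u s] rs rt /= /eqP ui ti.
have [|r rr [<- rz]] := star_mul_reduced rs rt; first by rewrite ui.
by apply: state_reduced => //; rewrite -size_eq0 rz.
Qed.

Inductive span (P : pred (seq (I * A))) : A -> Prop :=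
| span0 : span P 0
| span_cons c s x : P s -> reduced s -> span P x -> span P (c *: wprod s + x).

Lemma spanD P x y : span P x -> span P y -> span P (x + y).
Proof.
move=> sx sy; elim: sx => [|c s z Ps rs _ IH]; first by rewrite add0r.
by rewrite -addrA; apply: span_cons.
Qed.

Lemma spanZ P c x : span P x -> span P (c *: x).
Proof.
elim=> [|d s z Ps rs _ IH]; first by rewrite scaler0; exact: span0.
by rewrite scalerDr scalerA; apply: span_cons.
Qed.

Lemma span_word P s : P s -> reduced s -> span P (wprod s).
Proof.
move=> Ps rs; rewrite -[wprod s]scale1r -[X in span _ X]addr0.
by apply: span_cons => //; exact: span0.
Qed.

Lemma span_sub P Q x : (forall s, P s -> Q s) -> span P x -> span Q x.
Proof.
by move=> PQ; elim=> [|c s z Ps rs _ IH]; [exact: span0|apply: span_cons => //; exact: PQ].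
Qed.

Lemma span_orth i x y : span (starts i) x -> span (predC (starts i)) y -> E (star x * y) = 0.
Proof.
move=> sx sy; elim: sx => [|c s z Ps rs _ IHx]; first by rewrite star0 mul0r linear0.
rewrite starD mulrDl linearD /= IHx addr0 starZ -scalerAl linearZ /=.
elim: sy => [|d t w Pt rt _ IHy]; first by rewrite mulr0 linear0 mulr0.
rewrite mulrDr linearD mulrDr /= IHy addr0 -scalerAr linearZ /= (star_mul_reduced0 rs rt Ps Pt).
by rewrite !mulr0.
Qed.

Lemma span_center_mul i a x : B i a -> span (predC (starts i)) x ->
  span (starts i) (center a * x).
Proof.
move=> ba; elim=> [|c s z Ps rs _ IH]; first by rewrite mulr0; exact: span0.
rewrite mulrDr -scalerAr -(wprod_cons (i, center a)); apply: span_cons => //=; split=> //.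
  exact: subalg_center.
exact: state_center.
Qed.

Lemma center_mulE a x : a * x = E a *: x + center a * x.
Proof. by rewrite mulrBl -scalerAl mul1r addrC subrK. Qed.

(** Split [star a * a] into its expectation and its centred part: the latter sends [x] to words
    starting in [B i], which are orthogonal to [x]. *)
Lemma norm2_mul_span i a x : B i a -> span (predC (starts i)) x ->
  norm2 (a * x) = norm2 a * norm2 x.
Proof.
move=> ba sx; rewrite /norm2 -sqrtrM ?(dot_ge0 hE)//; congr Num.sqrt.
have baa : B i (star a * a) by apply: (star_subalgM (hB i)) => //; exact: (star_subalgS (hB i)).
rewrite dot_mull mulrA center_mulE dotDr // [X in _ + X = _](_ : _ = 0) ?addr0; last first.
  by rewrite (dotC hE) /dot (span_orth (span_center_mul baa sx) sx).
rewrite /dot -scalerAr linearZ /=; have := ger0_Im (state_positive hE a).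
by case: (E (star a * a)) => u v /= ->; case: (E _) => u' v' /=; rewrite mul0r subr0.
Qed.

Lemma span_split i x : span predT x -> exists p q,
  [/\ x = p + q, span (starts i) p & span (predC (starts i)) q].
Proof.
elim=> [|c s z _ rs _ [p [q [-> sp sq]]]].
  by exists 0, 0; rewrite addr0; split=> //; exact: span0.
have [si|si] := boolP (starts i s).
  by exists (c *: wprod s + p), q; rewrite addrA; split=> //; apply: span_cons.
by exists p, (c *: wprod s + q); rewrite addrCA; split=> //; apply: span_cons.
Qed.

Lemma span_mul i a x : B i a -> span predT x -> span predT (a * x).
Proof.
move=> ba.
have mulW b y : B i b -> span (predC (starts i)) y -> span predT (b * y).
  move=> bb sy; rewrite center_mulE; apply: spanD; first exact/spanZ/(span_sub _ sy).
  exact: span_sub (span_center_mul bb sy).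
move=> /(span_split i)[p [q [-> sp sq]]]; rewrite mulrDr; apply: spanD; last exact: mulW.
(* The first letter of a word starting in [B i] is absorbed into the multiplier; the remaining word
   does not start in [B i]. *)
elim: sp => [|c s z Ps rs _ IH]; first by rewrite mulr0; exact: span0.
rewrite mulrDr -scalerAr; apply: spanD => //; apply: spanZ.
case: s Ps rs => [//|u s] /= /eqP ui; rewrite ui => -[bu eu us rs]; rewrite wprod_cons mulrA.
by apply: mulW; [exact: (star_subalgM (hB _))|exact: span_word].
Qed.

Lemma norm2_star a : norm2 (star a) = norm2 a.
Proof. by rewrite /norm2 /dot starK (state_tracial hE). Qed.

(** The component [q] of [a * x] along words not starting in [B i] is bounded
    by the 2-norm of [a] because its adjoint is [q |-> star a * q]. *)
Lemma span_mul_split i a x : B i a -> span predT x -> exists p q,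
  [/\ a * x = p + q, span (starts i) p, span (predC (starts i)) q,
      norm2 p <= cnorm a * norm2 x & norm2 q <= norm2 a * norm2 x].
Proof.
move=> ba sx; have [p [q [e sp sq]]] := span_split i (span_mul ba sx).
have pq : dot p q = 0 by rewrite /dot (span_orth sp sq).
exists p, q; split=> //.
  apply: le_trans (norm2M_le hE a x).
  rewrite -ler_sqr ?nnegrE ?norm2_ge0// e norm2D_orth// lerDl sqr_ge0//.
have [->|q0] := eqVneq (norm2 q) 0; first by rewrite mulr_ge0 ?norm2_ge0.
have {}q0 : 0 < norm2 q by rewrite lt_neqAle eq_sym q0 norm2_ge0.
rewrite -(ler_pM2l q0) -expr2 (sqr_norm2 hE).
(* Since [p] is orthogonal to [q], pairing [q] with [q] equals pairing it with [a * x]. *)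
have -> : dot q q = dot (star a * q) x.
  by rewrite dot_mull starK e dotDr (dotC hE q p) pq add0r.
rewrite (le_trans (dot_le_norm2 hE _ _))// (norm2_mul_span (i := i))//.
  by rewrite norm2_star mulrA (mulrC (norm2 a)).
exact: (star_subalgS (hB _)).
Qed.

End ReducedWords.

(** * Norms of products of free identically distributed variables *)

Section ProductNorm.
Set Implicit Arguments.
Unset Strict Implicit.
Variables (R : realType) (A : cstarAlgType R) (E : {scalar A}).
Hypothesis hE : faithful_tracial_state E.
Implicit Types (x y : A).
Local Notation dot := (dot E).
Local Notation norm2 := (norm2 E).

Lemma generated_star_subalgebraP x : unital_star_subalgebra (generated_star_subalgebra x).
Proof.
split.
- by move=> M [[]].
- by move=> y z hy hz M hM; apply: (star_subalgD hM.1); [exact: hy|exact: hz].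
- by move=> c y hy M hM; apply: (star_subalgZ hM.1); exact: hy.
- by move=> y z hy hz M hM; apply: (star_subalgM hM.1); [exact: hy|exact: hz].
- by move=> y hy M hM; apply: (star_subalgS hM.1); exact: hy.
Qed.

Lemma generated_star_subalgebra_self x : generated_star_subalgebra x x.
Proof. by move=> M [_]; apply. Qed.

Lemma mixed_moment_power x k :
  mixed_moment E x (flatten (nseq k [:: true; false])) = E ((star x * x) ^+ k).
Proof.
rewrite /mixed_moment; congr (E _); elim: k => [|k IH]; first by rewrite big_nil.
by rewrite /= !big_cons IH exprS mulrA.
Qed.

Section IdenticallyDistributed.
Variables (I : Type) (X : I -> A).
Hypothesis hid : identically_distributed E X.

Lemma state_power_id i j k : E ((star (X i) * X i) ^+ k) = E ((star (X j) * X j) ^+ k).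
Proof. by rewrite -!mixed_moment_power; apply: hid. Qed.

Lemma norm2_id i j : norm2 (X i) = norm2 (X j).
Proof. by rewrite /norm2 /dot -[star (X i) * _]expr1 (state_power_id i j). Qed.

(** The moments of [star x * x] determine the norm: those at [i'] equal those at [j'], which powers
    of [cnorm (star (X j') * X j')] bound, and [cnorm_le_moments] applies. *)
Lemma cnorm_id i j : cnorm (X i) = cnorm (X j).
Proof.
suff le i' j' : cnorm (X i') <= cnorm (X j') by apply/le_anti; rewrite !le.
rewrite -ler_sqr ?nnegrE ?cnorm_ge0// -!cnorm_starM.
have sa l : star (star (X l) * X l) = star (X l) * X l by rewrite starM starK.
apply: (cnorm_le_moments hE) => //; first exact: cnorm_ge0.
move=> k.
have -> : norm2 ((star (X i') * X i') ^+ k) = norm2 ((star (X j') * X j') ^+ k).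
  by rewrite /norm2 /dot !starX !sa -!exprD (state_power_id i' j').
rewrite -[(_ * _) ^+ k]mulr1 (le_trans (norm2M_le hE _ _))//.
by rewrite norm2_1// mulr1 cnormX_le.
Qed.

End IdenticallyDistributed.

Variable X : nat -> A.
Hypothesis hfree : free_variables E X.
Variables (sg M : R).
Hypothesis X_norm2 : forall i, norm2 (X i) = sg.
Hypothesis X_cnorm : forall i, cnorm (X i) <= M.

Let B i := generated_star_subalgebra (X i).
Let hB i : unital_star_subalgebra (B i) := generated_star_subalgebraP (X i).
Let BX i : B i (X i) := @generated_star_subalgebra_self (X i).
Local Notation span := (span E B).
Local Notation T n := (\prod_(i < n) X i).

(** The empty word is accepted, so that [1] lies in each of these spans. *)
Let from (m : nat) (s : seq (nat * A)) := if s is u :: _ then (m <= u.1)%N else true.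

(** Peel off the last factor [X n]: words with first index above [n] do not start in [B n], so it
    scales the 2-norm by [sg], and the result is spanned by words of first index at least [n]. *)
Lemma norm2_prod_span n x : span (from n) x -> norm2 (T n * x) = sg ^+ n * norm2 x.
Proof.
elim: n x => [|n IH] x sx; first by rewrite big_ord0 !mul1r.
have sx' : span (predC (starts n)) x.
  by apply: span_sub sx => -[//|u s] /=; rewrite ltn_neqAle eq_sym => /andP[].
rewrite big_ord_recr -mulrA IH.
  by rewrite (norm2_mul_span hE hB hfree (@BX n))// X_norm2 exprSr mulrA.
rewrite (center_mulE E); apply: spanD.
  by apply: spanZ; apply: span_sub sx => -[//|u s] /=; exact: ltnW.
by apply: span_sub (span_center_mul hE hB (@BX n) sx') => -[//|u s] /= /eqP->.
Qed.

Lemma span_one (P : pred (seq (nat * A))) : P [::] -> span P 1.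
Proof. by move=> P0; have := @span_word _ _ E _ B P [::] P0 I; rewrite /wprod big_nil. Qed.

Lemma span_prod n x : span predT x -> span predT (T n * x).
Proof.
elim: n x => [|n IH] x sx; first by rewrite big_ord0 mul1r.
by rewrite big_ord_recr -mulrA; apply/IH/(span_mul hE hB (@BX n)).
Qed.

Lemma span_star_prod n x : span predT x -> span predT (star (T n) * x).
Proof.
elim: n x => [|n IH] x sx; first by rewrite big_ord0 star1 mul1r.
rewrite big_ord_recr starM -mulrA; apply/(span_mul hE hB (i := n)); last exact: IH.
exact: (star_subalgS (hB n)).
Qed.

Lemma sg_ge0 : 0 <= sg. Proof. by rewrite -(X_norm2 0); exact: norm2_ge0. Qed.
Lemma M_ge0 : 0 <= M. Proof. by rewrite (le_trans _ (X_cnorm 0))// cnorm_ge0. Qed.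

(** The solution of [N (n+1) = sg N n + M sg ^ n] with [N 0 = 1]; at [n = 0] the truncated exponent
    is harmless, its coefficient being zero. *)
Definition prod_bound n : R := sg ^+ n + n%:R * M * sg ^+ n.-1.

Lemma prod_bound_ge0 n : 0 <= prod_bound n.
Proof. by rewrite addr_ge0 ?mulr_ge0 ?exprn_ge0 ?sg_ge0 ?M_ge0. Qed.

(** Split [X n * x = p + q] by the first letter: [T n] is [sg ^ n] times an
    isometry on [p], whose words start in [B n], while passing to [q] costs
    only [sg]. *)
Lemma norm2_prod_le n x : span predT x -> norm2 (T n * x) <= prod_bound n * norm2 x.
Proof.
elim: n x => [|n IH] x sx.
  by rewrite big_ord0 mul1r /prod_bound !mul0r addr0 expr0 mul1r.
have [p [q [e sp sq hp hq]]] := span_mul_split hE hB hfree (@BX n) sx.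
rewrite big_ord_recr -mulrA e mulrDr (le_trans (norm2D_le hE _ _))//.
rewrite norm2_prod_span; last by apply: span_sub sp => -[//|u s] /= /eqP->.
have hq' : norm2 (T n * q) <= prod_bound n * (sg * norm2 x).
  rewrite (le_trans (IH q _))//; first by apply: span_sub sq.
  by rewrite ler_wpM2l ?prod_bound_ge0// -{1}(X_norm2 n).
have hp' : sg ^+ n * norm2 p <= sg ^+ n * (M * norm2 x).
  rewrite ler_wpM2l ?exprn_ge0 ?sg_ge0// (le_trans hp)// ler_wpM2r ?norm2_ge0//.
rewrite (le_trans (lerD hp' hq'))// le_eqVlt; apply/orP; left; apply/eqP.
rewrite /prod_bound; case: n {IH e sp sq hp hq hq' hp'} => [|n]; rewrite /= ?exprS ?expr0; ring.
Qed.

(** Duality: pair [y] with itself, move [T n] to the other side, apply the bound for [T n] to [y],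
    and divide by the 2-norm of [y]. *)
Lemma norm2_star_prod_le n x : span predT x ->
  norm2 (star (T n) * x) <= prod_bound n * norm2 x.
Proof.
move=> sx; set y := star (T n) * x.
have [->|y0] := eqVneq (norm2 y) 0; first by rewrite mulr_ge0 ?norm2_ge0 ?prod_bound_ge0.
have {}y0 : 0 < norm2 y by rewrite lt_neqAle eq_sym y0 norm2_ge0.
rewrite -(ler_pM2l y0) -expr2 (sqr_norm2 hE) {2}/y.
rewrite (dotC hE) dot_mull starK (dotC hE) (le_trans (dot_le_norm2 hE _ _))//.
rewrite [leRHS]mulrA ler_wpM2r ?norm2_ge0// [leRHS]mulrC norm2_prod_le//; exact: span_star_prod.
Qed.

(** All powers of [star (T n) * T n] lie in the span of reduced words, so 2-norm bounds on that span
    suffice for the moment criterion. *)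
Lemma cnorm_prod_le n : cnorm (T n) <= prod_bound n.
Proof.
rewrite -ler_sqr ?nnegrE ?cnorm_ge0 ?prod_bound_ge0// -cnorm_starM.
apply: (cnorm_le_moments hE); rewrite ?sqr_ge0 ?starM ?starK// => k.
set b := star _ * _.
have [] : span predT (b ^+ k) /\ norm2 (b ^+ k) <= (prod_bound n ^+ 2) ^+ k; last by [].
elim: k => [|k [sk hk]].
  by rewrite !expr0 norm2_1//; split=> //; exact: span_one.
have sT := span_prod n sk.
rewrite exprS /b -mulrA -/b; split; first exact: span_star_prod.
rewrite (le_trans (norm2_star_prod_le _ sT))//.
rewrite exprS expr2 -mulrA ler_wpM2l ?prod_bound_ge0//.
by rewrite (le_trans (norm2_prod_le _ sk))// ler_wpM2l ?prod_bound_ge0.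
Qed.

Lemma cnorm_prod_ge n : sg ^+ n <= cnorm (T n).
Proof.
have := norm2M_le hE (T n) 1.
by rewrite norm2_prod_span ?norm2_1 ?mulr1//; exact: span_one.
Qed.

End ProductNorm.

(** * Passage to logarithms *)

Lemma ln_root_cvg (R : realType) (u : nat -> R) (s K : R) : 0 < s -> 0 <= K ->
  (forall n, s ^+ n <= u n) -> (forall n, u n <= s ^+ n * (1 + n%:R * K)) ->
  (n%:R^-1 * ln (u n)) @[n --> \oo] --> ln s.
Proof.
move=> s0 K0 lo up; rewrite -cvg_shiftS /=.
(* The error term is [2 y / (n+1)], from [ln (y ^ 2) <= 2 y] with [y = sqrt (1 + (n+1) K) <= sqrt
   ((1 + K) (n+1))]. *)
pose v n := ln s + 2 * Num.sqrt (1 + K) * Num.sqrt (harmonic n : R).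
have vl : v @ \oo --> ln s.
  rewrite -[X in _ --> X]addr0 -[X in _ + X](mulr0 (2 * Num.sqrt (1 + K))).
  apply: cvgD; first exact: cvg_cst.
  apply: cvgM; first exact: cvg_cst.
  rewrite -[X in _ --> X](@sqrtr0 R).
  by apply: (continuous_cvg _ (@sqrt_continuous R 0)); exact: cvg_harmonic.
apply: (squeeze_cvgr _ (cvg_cst (ln s)) vl); apply: nearW => n.
have n0 : 0 < n.+1%:R :> R by rewrite ltr0n.
have sn : 0 < s ^+ n.+1 by rewrite exprn_gt0.
have un : 0 < u n.+1 := lt_le_trans sn (lo n.+1).
apply/andP; split.
  by rewrite mulrC ler_pdivlMr// mulr_natr -lnXn// ler_ln ?posrE.
have k0 : 0 < 1 + n.+1%:R * K by rewrite ltr_pwDl// mulr_ge0.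
rewrite mulrC ler_pdivrMr// (@le_trans _ _ (ln (s ^+ n.+1 * (1 + n.+1%:R * K))))//.
  by rewrite ler_ln ?posrE ?mulr_gt0.
rewrite lnM ?posrE// lnXn// -(mulr_natr (ln s)) /v [leRHS]mulrDl lerD2l.
set y := Num.sqrt (1 + n.+1%:R * K).
have y0 : 0 < y by rewrite sqrtr_gt0.
have -> : 1 + n.+1%:R * K = y ^+ 2 by rewrite sqr_sqrtr ?ltW.
rewrite lnXn// mulr2n (le_trans (lerD (ltW (ln_sublinear y0)) (ltW (ln_sublinear y0))))//.
rewrite -mulr2n -(mulr_natl y) -!mulrA ler_wpM2l//.
have -> : Num.sqrt (harmonic n : R) * n.+1%:R = Num.sqrt n.+1%:R.
  rewrite /harmonic sqrtrV// -{2}[n.+1%:R]sqr_sqrtr ?ler0n//.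
  by rewrite expr2 mulKf// gt_eqF// sqrtr_gt0.
rewrite -sqrtrM; last by rewrite addr_ge0.
rewrite /y ler_wsqrtr// mulrDl mul1r mulrC lerD2r ler1n//.
Qed.

Theorem corollary1 (R : realType) (A : cstarAlgType R) (E : {scalar A})
    (hE : faithful_tracial_state E) (X : nat -> A)
    (hfree : free_variables E X) (hid : identically_distributed E X)
    (j : nat) :
  ((n%:R^-1)%:E * lne (cnorm (\prod_(i < n) X i))%:E)%E @[n --> \oo] -->
    lne (Num.sqrt (complex.Re (E (star (X j) * X j))))%:E.
Proof.
change (((n%:R^-1)%:E * lne (cnorm (\prod_(i < n) X i))%:E)%E @[n --> \oo] -->
    lne (norm2 E (X j))%:E).
have X2 i : norm2 E (X i) = norm2 E (X j) by apply: norm2_id.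
have Xn i : cnorm (X i) <= cnorm (X j) by rewrite (cnorm_id hE hid i j).
have lo := cnorm_prod_ge hE hfree X2.
have up := cnorm_prod_le hE hfree X2 Xn.
have [s0|s_neq0] := eqVneq (norm2 E (X j)) 0.
  (* By faithfulness every [X i] is zero. The shift discards the empty product, which is [1]; all
     later terms are [-oo]. *)
  rewrite s0 le0_lneNy// -cvg_shiftS; apply: (@cvg_near_cst _ _ -oo%E).
  apply: nearW => n /=.
  rewrite big_ord_recr /= (norm2_eq0 hE (etrans (X2 n) s0)) mulr0 cnorm0 lexx.
  by rewrite gt0_muleNy// lte_fin invr_gt0 ltr0n.
have s0 : 0 < norm2 E (X j) by rewrite lt_neqAle eq_sym s_neq0 norm2_ge0.
rewrite lne_EFin//.
have -> : (fun n => ((n%:R^-1)%:E * lne (cnorm (\prod_(i < n) X i))%:E)%E) =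
    EFin \o (fun n => n%:R^-1 * ln (cnorm (\prod_(i < n) X i))).
  by apply/funext => n; rewrite [RHS]/= lne_EFin// (lt_le_trans _ (lo n))// exprn_gt0.
apply: cvg_EFin; first exact: nearW.
(* With [s = norm2 E (X j)], this [K] rewrites [n (cnorm (X j)) s ^ (n-1)] as [s ^ n (n K)]. *)
apply: (@ln_root_cvg _ _ _ (cnorm (X j) / norm2 E (X j))) => //.
  by rewrite divr_ge0 ?cnorm_ge0// ltW.
move=> n; rewrite (le_trans (up n))// /prod_bound mulrDr mulr1 lerD2l.
case: n => [|n]; first by rewrite !mul0r mulr0.
rewrite le_eqVlt; apply/orP; left; apply/eqP; rewrite exprS /=; by field.
Qed.
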